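(* Let $(E,\nu)$ be a Euclidean domain that is not a field and let $B\in E$ be a nonzero nonunit. Assume that for every prime $\pi\in E$ with $\pi\nmid B$: (a) $B$ has finite multiplicative order modulo $\pi$, and (b) there exists a unique prime integer $\pi'\in\mathbb{Z}$ such that $\pi\mid\pi'$ in $E$, and $\pi'\neq 0$ in $E$. Let $p\in E$ be a prime with $p\nmid B$, let $p'$ be the prime integer divisible by $p$ in $E$, let $f$ be the largest integer such that $p^f\mid p'$ in $E$, and for $n\ge 1$ let $q_n$ be the order of $B$ in $(E/p^nE)^\times$. Then for all $n\in\mathbb{N}$, $q_{n+1}=q_n$ or $q_{n+1}=p'q_n$. Now let $g$ be the least natural number such that (i) $g>f/(p'-1)$ and (ii) $q_{g+1}=p'q_g$. Then for all $n\ge 0$, $$q_{g+n}=(p')^{\lceil n/f\rceil}\,q_g .$$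
   Context: A Euclidean domain $(E,\nu)$ is a commutative integral domain $E$ with unity together with a function $\nu:E\setminus\{0\}\to\mathbb{N}_0$ such that (a) for all $s\in E$ and $0\neq d\in E$ there exist $q,r\in E$ with $s=dq+r$ and $r=0$ or $\nu(r)<\nu(d)$; (b) $\nu(ab)\ge\nu(a)$ for all nonzero $a,b\in E$. $\mathbb{N}=\{1,2,\dots\}$. Integers are regarded as elements of $E$ via the canonical map $\mathbb{Z}\to E$; a prime integer is a (positive) prime number of $\mathbb{Z}$, which need not be prime in $E$. $\lceil x\rceil$ is the least integer $\ge x$. Under the stated assumptions $B$ has finite order modulo $p^n$ for every $n$, so $q_n$ is a well-defined positive integer. *)

(* Defs.v *)
From mathcomp Require Import all_boot all_order all_algebra.
From mathcomp Require Import boolp.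

Set Implicit Arguments.
Unset Strict Implicit.
Unset Printing Implicit Defensive.

Import Order.TTheory GRing.Theory Num.Theory.
Local Open Scope ring_scope.

(* nu is a total function, but nu 0 is never constrained nor used. *)
Definition euclidean_function (E : idomainType) (nu : E -> nat) : Prop :=
  (forall s d : E, d != 0 ->
     exists q r : E, s = d * q + r /\ (r = 0 \/ (nu r < nu d)%N)) /\
  (forall a b : E, a != 0 -> b != 0 -> (nu a <= nu (a * b)%R)%N).

Definition rdvd (E : idomainType) (d a : E) : Prop := exists c : E, a = d * c.

Definition prime_elt (E : idomainType) (x : E) : Prop :=
  [/\ x != 0, x \isn't a GRing.unit &
      forall a b : E, rdvd x (a * b) -> rdvd x a \/ rdvd x b].

(* k >= 1 and b ^ k = 1 in E / mE; such a b is automatically a unit mod m. *)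
Definition pow_eq1_mod (E : idomainType) (b m : E) (k : nat) : Prop :=
  (0 < k)%N /\ rdvd m (b ^+ k - 1).

Definition finite_order_mod (E : idomainType) (b m : E) : Prop :=
  exists k : nat, pow_eq1_mod b m k.

Lemma finite_order_modW (E : idomainType) (b m : E) :
  finite_order_mod b m -> exists k : nat, `[< pow_eq1_mod b m k >].
Proof. by case=> k hk; exists k; apply/asboolP. Qed.

(* The order of b in the unit group of E / mE; 0 if b has infinite order or is
   not a unit modulo m. *)
Definition order_mod (E : idomainType) (b m : E) : nat :=
  if pselect (finite_order_mod b m) is left h
  then ex_minn (finite_order_modW h) else 0%N.

Definition is_least (P : nat -> Prop) (g : nat) : Prop :=
  P g /\ forall h : nat, P h -> (g <= h)%N.

Definition is_largest (P : nat -> Prop) (f : nat) : Prop :=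
  P f /\ forall h : nat, P h -> (h <= f)%N.

(* Main.v *)
Require Import Defs.
From mathcomp Require Import all_boot all_order all_algebra.
From mathcomp Require Import boolp ring zify.

(** Write B ^ q_n = 1 + p ^ n c. Raising to the power p' and expanding with the
    binomial theorem gives q_n %| q_(n+1) %| p' q_n. When p does not divide c
    and n > f / (p' - 1), the linear term p' p ^ n c strictly dominates, so the
    p-adic valuation of B ^ (q_g p' ^ k) - 1 is exactly g + k f, which
    determines q_(g+n). If no admissible g existed, q_n would be eventually
    constant, so some B ^ q - 1 with q > 0 would be divisible by every p ^ n,
    hence zero, contradicting that B is not a unit. *)

Set Implicit Arguments.
Unset Strict Implicit.
Unset Printing Implicit Defensive.

Import Order.TTheory GRing.Theory Num.Theory.
Local Open Scope ring_scope.

Section Divisibility.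
Variable E : idomainType.
Implicit Types (a b c d m p x : E).

Lemma rdvdD m a b : rdvd m a -> rdvd m b -> rdvd m (a + b).
Proof. by case=> c -> [d ->]; exists (c + d); rewrite mulrDr. Qed.

Lemma rdvdB m a b : rdvd m a -> rdvd m b -> rdvd m (a - b).
Proof. by case=> c -> [d ->]; exists (c - d); rewrite mulrBr. Qed.

Lemma rdvdMl m a b : rdvd m b -> rdvd m (a * b).
Proof. by case=> c ->; exists (a * c); rewrite mulrCA. Qed.

Lemma rdvdMr m a b : rdvd m a -> rdvd m (a * b).
Proof. by case=> c ->; exists (c * b); rewrite mulrA. Qed.

Lemma rdvd_trans d m a : rdvd m d -> rdvd d a -> rdvd m a.
Proof. by move=> + [c ->]; exact: rdvdMr. Qed.

Lemma rdvd_exp p (m n : nat) : (m <= n)%N -> rdvd (p ^+ m) (p ^+ n).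
Proof. by move=> /subnKC <-; exists (p ^+ (n - m)); rewrite exprD. Qed.

(** If [k < m], cancelling [p ^+ k] would leave [p] dividing [c]. *)
Lemma rdvd_exp_exact p c (k m : nat) : p != 0 -> ~ rdvd p c ->
  rdvd (p ^+ m) (p ^+ k * c) -> (m <= k)%N.
Proof.
move=> p0 npc [d hd]; rewrite leqNgt; apply/negP => /subnKC km; apply: npc.
exists (p ^+ (m - k.+1) * d); apply: (mulfI (expf_neq0 k p0)).
by rewrite hd -{1}km addSnnS exprD exprS; ring.
Qed.

Lemma prime_eltM p a b :
  prime_elt p -> ~ rdvd p a -> ~ rdvd p b -> ~ rdvd p (a * b).
Proof. by case=> _ _ hp na nb /hp[]. Qed.

(** Dividing [a] by [a * b] leaves a remainder [a * (1 - b * q)], nonzero because [b] is not a unit;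
    its [nu] is at least [nu a] and below [nu (a * b)]. *)
Lemma euclidean_proper_mul (nu : E -> nat) a b : euclidean_function nu ->
  a != 0 -> b != 0 -> b \isn't a GRing.unit -> (nu a < nu (a * b)%R)%N.
Proof.
case=> hdiv hmul a0 b0 bu.
have [q [r [e hr]]] := hdiv a (a * b) (mulf_neq0 a0 b0).
have re : r = a * (1 - b * q).
  by rewrite mulrBr mulr1 mulrA {1}e addrAC subrr add0r.
have h1 : 1 - b * q != 0.
  apply: contra bu; rewrite subr_eq0 => /eqP h.
  by apply/unitrPr; exists q.
case: hr => [r0|].
  by move/eqP: r0; rewrite re mulf_eq0 (negbTE a0) (negbTE h1).
by apply: leq_ltn_trans; rewrite re; exact: hmul.
Qed.

(** Each factor [p] raises [nu], so a nonzero multiple of [p ^+ n] has [nu] at least [n]; for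
    nonzero [x] this fails at [n = nu x + 1]. *)
Lemma euclidean_exp_dvd_eq0 (nu : E -> nat) p x : euclidean_function nu ->
  p != 0 -> p \isn't a GRing.unit ->
  (forall n, rdvd (p ^+ n) x) -> x = 0.
Proof.
move=> hnu p0 pu hx; apply/eqP; apply/negPn/negP => x0.
have lb n c : c != 0 -> (n <= nu (c * p ^+ n)%R)%N.
  move=> c0; elim: n => // n IH; apply: (leq_ltn_trans IH).
  by rewrite exprSr mulrA euclidean_proper_mul // mulf_neq0 // expf_neq0.
have [c e] := hx (nu x).+1.
have c0 : c != 0 by apply: contraNneq x0 => c0; rewrite e c0 mulr0.
by have := lb (nu x).+1 c c0; rewrite mulrC -e ltnn.
Qed.

Lemma order_mod_pow b m : finite_order_mod b m ->
  pow_eq1_mod b m (order_mod b m).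
Proof.
rewrite /order_mod => h; case: pselect => // h'.
by case: ex_minnP => k /asboolP.
Qed.

Lemma order_mod_min b m k : pow_eq1_mod b m k -> (order_mod b m <= k)%N.
Proof.
move=> hk; rewrite /order_mod; case: pselect => // h.
by case: ex_minnP => j _; apply; apply/asboolP.
Qed.

Lemma rdvd_exprM_sub1 b m k j : rdvd m (b ^+ k - 1) -> rdvd m (b ^+ (k * j) - 1).
Proof. by move=> h; rewrite exprM subrX1; exact: rdvdMr. Qed.

Lemma order_mod_dvdn b m k : finite_order_mod b m ->
  rdvd m (b ^+ k - 1) <-> (order_mod b m %| k)%N.
Proof.
move=> /order_mod_pow[o0 ho]; split=> [hk|/dvdnP[j ->]]; last first.
  by rewrite mulnC; exact: rdvd_exprM_sub1.
have hr : rdvd m (b ^+ (k %% order_mod b m) - 1).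
  set r := (k %% _)%N; set s := (order_mod b m * (k %/ order_mod b m))%N.
  have -> : b ^+ r - 1 = (b ^+ k - 1) - b ^+ r * (b ^+ s - 1).
    rewrite (_ : k = r + s)%N; last by rewrite /s mulnC addnC -divn_eq.
    by rewrite exprD; ring.
  by apply: rdvdB hk _; apply: rdvdMl; exact: rdvd_exprM_sub1.
rewrite /dvdn; case: posnP => // r0.
by have := order_mod_min (conj r0 hr); rewrite leqNgt ltn_mod o0.
Qed.

(** A prime [l] divides its middle binomial coefficients, so the terms of degree 2 to [l - 1] share
    the factor [l%:R * x ^+ 2]. The term [x ^+ l], with coefficient 1, stays apart. *)
Lemma prime_binomial x l : prime l ->
  exists d, (1 + x) ^+ l = 1 + l%:R * x + l%:R * x ^+ 2 * d + x ^+ l.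
Proof.
case: l => [//|[//|k]] pl; rewrite exprDn.
exists (\sum_(i < k) ('C(k.+2, i.+2) %/ k.+2)%:R * x ^+ i).
rewrite 2!big_ord_recl big_ord_recr /= !expr1n !mul1r bin0 bin1 expr0 !mulr1n.
rewrite binn mulr1n addrA addrA /bump /= !add1n expr1 -mulr_natl; congr (_ + _ + _).
rewrite mulr_sumr; apply: eq_bigr => i _; rewrite expr1n mul1r.
rewrite -mulr_natl -{1}(divnK (prime_dvd_bin pl _)) //; last first.
  by rewrite /= !ltnS ltn_ord.
by rewrite !add1n natrM -[i.+2]addn2 exprD mulrACA mulrC.
Qed.

(** With [x = a - 1], the terms with coefficient [l] gain a factor [p] from [l], and [x ^+ l]
    carries [p ^+ (n * l)] with [n * l > n]. *)
Lemma rdvd_exp_prime_lift p a n l : prime l -> rdvd p l%:R -> (0 < n)%N ->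
  rdvd (p ^+ n) (a - 1) -> rdvd (p ^+ n.+1) (a ^+ l - 1).
Proof.
move=> pl [u pu] n0 [c hc]; have -> : a = 1 + p ^+ n * c by rewrite -hc addrC subrK.
have [d ->] := prime_binomial (p ^+ n * c) pl.
set x := p ^+ n * c.
have -> : 1 + l%:R * x + l%:R * x ^+ 2 * d + x ^+ l - 1 =
  p ^+ n.+1 * (u * c * (1 + x * d)) + x ^+ l by rewrite pu [p ^+ n.+1]exprS /x; ring.
apply: rdvdD; first by apply: rdvdMr; exists 1; rewrite mulr1.
rewrite exprMn -exprM; apply: rdvdMr; apply: rdvd_exp.
by have := prime_gt1 pl; nia.
Qed.

(** The linear term has valuation exactly [n + f]; the middle terms have at least [2 n + f], and the
    last one at least [l * n], which is larger by assumption. *)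
Lemma exact_exp_prime_lift p a c u n l f : prime_elt p -> prime l ->
  l%:R = p ^+ f * u -> ~ rdvd p u -> (0 < n)%N -> (n + f < l * n)%N ->
  a - 1 = p ^+ n * c -> ~ rdvd p c ->
  exists2 c', a ^+ l - 1 = p ^+ (n + f) * c' & ~ rdvd p c'.
Proof.
move=> pp pl lu npu n0 nf hc npc.
have -> : a = 1 + p ^+ n * c by rewrite -hc addrC subrK.
have [d ->] := prime_binomial (p ^+ n * c) pl.
(* The expansion divided by [p ^+ (n + f)]: modulo [p] only [u * c], from the linear term,
   survives. *)
exists (u * c + p * (p ^+ n.-1 * u * c ^+ 2 * d
                     + p ^+ (l * n - (n + f).+1) * c ^+ l)).
  have -> : (p ^+ n * c) ^+ l =
    p ^+ (n + f) * p * p ^+ (l * n - (n + f).+1) * c ^+ l.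
    by rewrite exprMn -exprM mulnC -exprSr -exprD subnKC.
  rewrite lu exprD (_ : p ^+ n = p * p ^+ n.-1); first by ring.
  by rewrite -exprS prednK.
move=> h; apply: (prime_eltM pp npu npc).
rewrite -[u * c](addrK (p * (p ^+ n.-1 * u * c ^+ 2 * d
                     + p ^+ (l * n - (n + f).+1) * c ^+ l))).
by apply: rdvdB => //; apply: rdvdMr; exists 1; rewrite mulr1.
Qed.

Lemma finite_order_mod_exp b p l n : prime l -> rdvd p l%:R ->
  finite_order_mod b p -> finite_order_mod b (p ^+ n).
Proof.
move=> pl pdl [k0 hk0].
case: n => [|n]; first by exists 1%N; split=> //; exists (b ^+ 1 - 1); rewrite mul1r.
elim: n => [|n [k [k1 hk]]]; first by exists k0; rewrite expr1.
exists (k * l)%N; split; first by rewrite muln_gt0 k1 prime_gt0.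
by rewrite exprM; exact: rdvd_exp_prime_lift.
Qed.

End Divisibility.

Lemma absz_ceil_leq (n f j : nat) : (0 < f)%N ->
  (`|Num.ceil (n%:R / f%:R : rat)| <= j)%N = (n <= j * f)%N.
Proof.
move=> f0; have f0' : 0 < f%:R :> rat by rewrite ltr0n.
have c0 : 0 <= Num.ceil (n%:R / f%:R : rat).
  by rewrite -(ceil0 rat) le_ceil // divr_ge0 ?ler0n.
by rewrite -lez_nat gez0_abs // ceil_le_int ler_pdivrMr // -natrM ler_nat.
Qed.

(** Clearing the denominator turns condition (i) into the dominance hypothesis of
    [exact_exp_prime_lift]. *)
Lemma ltr_nat_div_pred (g f l : nat) : (1 < l)%N ->
  (g%:R > f%:R / (l%:R - 1) :> rat) = (g + f < l * g)%N.
Proof.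
move=> l1; have l0 : 0 < l%:R - 1 :> rat by rewrite subr_gt0 ltr1n.
rewrite ltr_pdivrMr // mulrBr mulr1 ltrBrDl -natrM -natrD ltr_nat.
by rewrite [(l * g)%N]mulnC.
Qed.

Theorem theorem4 (E : idomainType) (nu : E -> nat)
  (hnu : euclidean_function nu) (hE : ~ GRing.field_axiom E)
  (B : E) (hB0 : B != 0) (hBu : B \isn't a GRing.unit)
  (ha : forall x : E, prime_elt x -> ~ rdvd x B -> finite_order_mod B x)
  (hb : forall x : E, prime_elt x -> ~ rdvd x B ->
     exists x' : nat,
       unique (fun l : nat => prime l /\ rdvd x l%:R) x' /\ x'%:R != 0 :> E)
  (p : E) (hp : prime_elt p) (hpB : ~ rdvd p B)
  (p' : nat) (hp' : prime p') (hpp' : rdvd p p'%:R)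
  (f : nat) (hf : is_largest (fun k : nat => rdvd (p ^+ k) p'%:R) f) :
  let q := fun n : nat => order_mod B (p ^+ n) in
  let admissible := fun g : nat =>
    [/\ (0 < g)%N,
        g%:R > f%:R / (p'%:R - 1) :> rat &
        q g.+1 = (p' * q g)%N] in
  (forall n : nat, (0 < n)%N -> q n.+1 = q n \/ q n.+1 = (p' * q n)%N) /\
  (exists g : nat, is_least admissible g) /\
  (forall g : nat, is_least admissible g ->
     forall n : nat,
       q (g + n)%N = (p' ^ `|Num.ceil (n%:R / f%:R : rat)%R| * q g)%N).
Proof.
move=> q admissible; have [p0 pu _] := hp.
have fin n : finite_order_mod B (p ^+ n).
  exact: finite_order_mod_exp hp' hpp' (ha p hp hpB).
have qP n k : rdvd (p ^+ n) (B ^+ k - 1) <-> (q n %| k)%N by exact: order_mod_dvdn.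
have q0 n : (0 < q n)%N by have [] := order_mod_pow (fin n).
have qmono n m : (n <= m)%N -> (q n %| q m)%N.
  by move=> nm; apply/qP; apply: rdvd_trans (rdvd_exp p nm) _; apply/qP.
have step n : (0 < n)%N -> q n.+1 = q n \/ q n.+1 = (p' * q n)%N.
  move=> n0; have /dvdnP[m e] := qmono n n.+1 (leqnSn n).
  have : (q n.+1 %| p' * q n)%N.
    apply/qP; rewrite mulnC exprM; apply: rdvd_exp_prime_lift => //.
    exact/qP.
  (* The quotient [m] of the two orders divides the prime [p']. *)
  rewrite e dvdn_pmul2r //; have [_ /[apply]] := primeP hp'.
  by case/orP=> /eqP ->; [left; rewrite mul1n|right].
have p'1 := prime_gt1 hp'.
split=> //; split.
  suff [g hg] : exists g, admissible g.
    have ex : exists g, `[< admissible g >] by exists g; apply/asboolP.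
    case: (ex_minnP ex) => m /asboolP hm hmin; exists m; split=> // h hh.
    by apply: hmin; apply/asboolP.
  apply: contrapT => none.
  (* Since [p' >= 2], every index above [f] satisfies (i), so without an admissible index the order
     can no longer jump. *)
  have const n : q (f.+1 + n)%N = q f.+1.
    elim: n => [|n IH]; first by rewrite addn0.
    rewrite addnS -IH; have [//|e] := step (f.+1 + n)%N isT.
    case: none; exists (f.+1 + n)%N; split=> //.
    by rewrite ltr_nat_div_pred //; nia.
  have /eqP : B ^+ q f.+1 - 1 = 0.
    apply: (euclidean_exp_dvd_eq0 hnu p0 pu) => n.
    apply: rdvd_trans (rdvd_exp p (leq_addl f.+1 n)) _.
    by apply/qP; rewrite const.
  rewrite subr_eq0 => /eqP e; case/negP: hBu.
  by rewrite -(unitrX_pos _ (q0 f.+1)) e unitr1.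
move=> g [[g0 hg qg] _] n.
rewrite ltr_nat_div_pred // in hg.
have [[u lu] fmax] := hf.
have npu : ~ rdvd p u.
  case=> v uv; have : rdvd (p ^+ f.+1) p'%:R.
    by exists v; rewrite lu uv exprSr mulrA.
  by move/fmax; rewrite ltnn.
have f0 : (0 < f)%N by apply: fmax; rewrite expr1.
have val k : exists2 c, B ^+ (q g * p' ^ k) - 1 = p ^+ (g + k * f) * c & ~ rdvd p c.
  elim: k => [|k [c e npc]].
    (* If [p] divided [c], then [q g.+1] would divide [q g], against [q g.+1 = p' * q g]. *)
    have /qP[c e] := dvdnn (q g); exists c; first by rewrite muln1 addn0.
    case=> d cd; have : (q g.+1 %| q g)%N.
      by apply/qP; exists d; rewrite e cd exprSr mulrA.
    by move/(dvdn_leq (q0 g)); rewrite qg; have := q0 g; nia.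
  rewrite expnSr mulnA exprM mulSn [(f + _)%N]addnC addnA.
  apply: (exact_exp_prime_lift hp hp' lu npu _ _ e npc); first by rewrite addn_gt0 g0.
  (* The dominance inequality at [g] persists when [g] grows to [g + k * f]. *)
  by nia.
have qval k : (q (g + n)%N %| q g * p' ^ k)%N = (n <= k * f)%N.
  have [c e npc] := val k; apply/idP/idP.
    move/qP; rewrite e => /(rdvd_exp_exact p0 npc).
    by rewrite leq_add2l.
  move=> nk; apply/qP; rewrite e; apply: rdvdMr.
  by apply: rdvd_exp; rewrite leq_add2l.
set k := `|_|%N.
(* The quotient [m] divides [p' ^ k], hence equals [p' ^ j] with [j <= k]. Applying [qval] to [j]
   gives [n <= j * f], so the ceiling [k] is at most [j]. *)
have /dvdnP[m e] := qmono g (g + n)%N (leq_addr n g).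
have : (q (g + n)%N %| q g * p' ^ k)%N by rewrite qval -absz_ceil_leq.
rewrite e mulnC dvdn_pmul2l // => /(dvdn_pfactor _ _ hp')[j jk mj].
suff -> : k = j by rewrite mj mulnC.
apply/eqP; rewrite eqn_leq jk andbT absz_ceil_leq // -qval e mj mulnC.
by rewrite dvdnn.
Qed.
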